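(* Let $\lambda,\chi,\psi,\varphi\in\mathbb{R}$ with $(\lambda,\chi,\psi)$ admissible, let $\xi\sim GH_1(\lambda,\chi,\psi,0,1,\varphi)$, and let $f_\xi$ be its density. Then: \begin{itemize} \item If $\psi>0$, then for every $\alpha\in\mathbb{R}$ there exists $t^*(\alpha)>0$ such that $f_\xi$ is $\alpha$-decreasing on $(t^*(\alpha),+\infty)$, i.e. $f_\xi$ is $\alpha$-decreasing with threshold $t^*(\alpha)$. \item Suppose $\psi=0$ and $\varphi\neq 0$. If $\varphi<0$, then $f_\xi$ is $\alpha$-decreasing for every $\alpha\in\mathbb{R}$. If $\varphi>0$, then $f_\xi$ is $\alpha$-decreasing for every $\alpha<1-\lambda$. \item Suppose $\psi=0$ and $\varphi=0$. Then $f_\xi$ is $\alpha$-decreasing if and only if $\lambda<0$ and $\alpha<1-2\lambda$. \end{itemize}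
   Context: A function $f:\mathbb{R}\to\mathbb{R}$ is called $\alpha$-decreasing, for $\alpha\in\mathbb{R}$, if $f$ is continuous on $(0,+\infty)$ and there exists $t^*(\alpha)>0$ (a threshold) such that $t\mapsto t^\alpha f(t)$ is strictly decreasing on $(t^*(\alpha),+\infty)$. $K_\nu$ ($\nu\in\mathbb{R}$) denotes the modified Bessel function of the third kind (also called of the second kind), $K_\nu(x)=\frac12\int_0^\infty u^{\nu-1}e^{-\frac{x}{2}(u+u^{-1})}\,du$, $x>0$. The triple $(\lambda,\chi,\psi)$ is admissible if: $\chi>0,\psi\ge0$ when $\lambda<0$; $\chi>0,\psi>0$ when $\lambda=0$; $\chi\ge0,\psi>0$ when $\lambda>0$. The generalized inverse Gaussian distribution $Gig(\lambda,\chi,\psi)$ has density on $(0,\infty)$ $$h(t)=\frac{\chi^{-\lambda}(\sqrt{\chi\psi})^{\lambda}}{2K_\lambda(\sqrt{\chi\psi})}\,t^{\lambda-1}\exp\!\left(-\tfrac12(\chi t^{-1}+\psi t)\right)$$ if $\chi,\psi>0$; for $\psi=0$ (so $\lambda<0,\chi>0$) it is the inverse gamma distribution with density $\left(\frac{\chi}{2}\right)^{-\lambda}\Gamma(-\lambda)^{-1}t^{\lambda-1}e^{-\chi/(2t)}$; for $\chi=0$ (so $\lambda>0,\psi>0$) it is the gamma distribution with density $\frac{(\psi/2)^\lambda}{\Gamma(\lambda)}t^{\lambda-1}e^{-\psi t/2}$. $GH_1(\lambda,\chi,\psi,\mu,\sigma^2,\varphi)$ ($\sigma>0$) is the law of $\mu+W\varphi+\sqrt{W}\,\sigma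 Z$ with $Z\sim\mathcal N(0,1)$ and $W\sim Gig(\lambda,\chi,\psi)$ independent. The density of $GH_1(\lambda,\chi,\psi,0,1,\varphi)$ is $f_\xi(t)=\int_0^\infty(2\pi\omega)^{-1/2}\exp\left(\varphi t-\frac{t^2}{2\omega}-\frac{\varphi^2\omega}{2}\right)h(\omega)\,d\omega$, where $h$ is the density of $W$. For $\chi,\psi>0$ it equals $c\,K_{\lambda-\frac12}(S(t))\,e^{\varphi t}\,S(t)^{\lambda-\frac12}$ with $S(t)=\sqrt{(\chi+t^2)(\psi+\varphi^2)}$ and $c=\frac{(\sqrt{\chi\psi})^{-\lambda}\psi^\lambda(\psi+\varphi^2)^{\frac12-\lambda}}{\sqrt{2\pi}\,K_\lambda(\sqrt{\chi\psi})}$; for $\chi\psi=0$ this closed form is understood as a limit. *)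

(* Defs.v *)
From HB Require Import structures.
From mathcomp Require Import all_boot all_order all_algebra.
From mathcomp Require Import all_classical all_reals all_analysis.
Import Order.TTheory GRing.Theory Num.Theory.
Import numFieldNormedType.Exports.

Set Implicit Arguments.
Unset Strict Implicit.
Unset Printing Implicit Defensive.

Local Open Scope classical_set_scope.
Local Open Scope ring_scope.

Section special_functions.
Context {R : realType}.
Notation mu := (@lebesgue_measure R).

(* Modified Bessel function of the third (second) kind, for x > 0. *)
Definition besselK (nu x : R) : R :=
  2^-1 * \int[mu]_(u in `]0, +oo[) (u `^ (nu - 1) * expR (- (x / 2) * (u + u^-1))).

(* Euler's Gamma function, for a > 0. *)
Definition Gamma (a : R) : R :=
  \int[mu]_(u in `]0, +oo[) (u `^ (a - 1) * expR (- u)).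

End special_functions.

Section gig.
Context {R : realType}.
Implicit Types lambda chi psi : R.

Definition gig_admissible lambda chi psi : Prop :=
  [/\ lambda < 0 -> 0 < chi /\ 0 <= psi,
      lambda = 0 -> 0 < chi /\ 0 < psi &
      0 < lambda -> 0 <= chi /\ 0 < psi].

(* The density on ]0, +oo[; it is only ever evaluated there. For admissible
   parameters at most one of chi and psi vanishes. *)
Definition gig_pdf lambda chi psi (t : R) : R :=
  if psi == 0 then
    (chi / 2) `^ (- lambda) / Gamma (- lambda) *
      t `^ (lambda - 1) * expR (- chi / (2 * t))
  else if chi == 0 then
    (psi / 2) `^ lambda / Gamma lambda *
      t `^ (lambda - 1) * expR (- (psi * t) / 2)
  else
    chi `^ (- lambda) * Num.sqrt (chi * psi) `^ lambda /
        (2 * besselK lambda (Num.sqrt (chi * psi))) *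
      t `^ (lambda - 1) * expR (- 2^-1 * (chi * t^-1 + psi * t)).

End gig.

Section laws.
Context {R : realType}.
Notation mu := (@lebesgue_measure R).

Definition indep_RV d (T : measurableType d) (P : probability T R)
    (X Y : {RV P >-> R}) : Prop :=
  forall A B : set R, measurable A -> measurable B ->
    P (X @^-1` A `&` Y @^-1` B) = (P (X @^-1` A) * P (Y @^-1` B))%E.

Definition has_gig_law d (T : measurableType d) (P : probability T R)
    (W : {RV P >-> R}) (lambda chi psi : R) : Prop :=
  forall A : set R, measurable A ->
    distribution P W A =
    (\int[mu]_(t in (A `&` `]0, +oo[)%R) (gig_pdf lambda chi psi t)%:E)%E.

Definition has_normal_law d (T : measurableType d) (P : probability T R)
    (Z : {RV P >-> R}) (m s : R) : Prop :=
  forall A : set R, measurable A -> distribution P Z A = normal_prob m s A.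

(* W and Z may live on another probability space: only the law of X matters. *)
Definition has_gh1_law d (T : measurableType d) (P : probability T R)
    (X : {RV P >-> R}) (lambda chi psi m sigma2 phi : R) : Prop :=
  exists (d' : measure_display) (T' : measurableType d')
    (P' : probability T' R) (W Z : {RV P' >-> R}),
  [/\ has_gig_law W lambda chi psi,
      has_normal_law Z 0 1,
      indep_RV W Z &
      forall A : set R, measurable A ->
        distribution P X A =
        P' [set w | A (m + W w * phi +
                       Num.sqrt (W w) * Num.sqrt sigma2 * Z w)]].

Definition has_density d (T : measurableType d) (P : probability T R)
    (X : {RV P >-> R}) (f : R -> R) : Prop :=
  [/\ measurable_fun setT f,
      forall t, 0 <= f t &
      forall A : set R, measurable A ->
        distribution P X A = (\int[mu]_(t in A) (f t)%:E)%E].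

(* Normal variance-mean mixture formula for the density of
   GH_1(lambda, chi, psi, 0, 1, phi). At t = 0 the integral may diverge
   (e.g. chi = 0 and lambda <= 1/2). *)
Definition gh1_pdf (lambda chi psi phi t : R) : R :=
  \int[mu]_(w in `]0, +oo[)
    ((2 * pi * w) `^ (- 2^-1) *
     expR (phi * t - t ^+ 2 / (2 * w) - phi ^+ 2 * w / 2) *
     gig_pdf lambda chi psi w).

(* A density is only determined almost everywhere; this fixes the version
   given by the mixture formula. *)
Definition is_gh1_density d (T : measurableType d) (P : probability T R)
    (X : {RV P >-> R}) (lambda chi psi phi : R) (f : R -> R) : Prop :=
  has_density X f /\
  forall t, t != 0 -> f t = gh1_pdf lambda chi psi phi t.

End laws.

Section alpha_decreasing.
Context {R : realType}.

Definition alpha_decreasing_above (f : R -> R) (alpha t0 : R) : Prop :=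
  {within `]0, +oo[, continuous f} /\
  forall s t : R, t0 < s -> s < t -> t `^ alpha * f t < s `^ alpha * f s.

Definition alpha_decreasing (f : R -> R) (alpha : R) : Prop :=
  exists2 t0 : R, 0 < t0 & alpha_decreasing_above f alpha t0.

End alpha_decreasing.

(* Main.v *)
Require Import Defs.
From mathcomp Require Import all_boot all_order all_algebra.
From mathcomp Require Import all_classical all_reals all_analysis.
From mathcomp Require Import measurable_realfun lebesgue_integral_under ring lra.
Import Order.TTheory GRing.Theory Num.Theory.
Import numFieldNormedType.Exports.

Set Implicit Arguments.
Unset Strict Implicit.
Unset Printing Implicit Defensive.

Local Open Scope classical_set_scope.
Local Open Scope ring_scope.
Local Notation leb := lebesgue_measure.

(** Write p = lambda - 1/2, beta = phi^2 + psi and s = chi + t^2. Collecting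
    powers and exponentials in the mixture formula gives, for t != 0,

      f t = C e^(phi t) I(s),
      I(s) = int_0^oo w^(p-1) exp(-(s/w + beta w)/2) dw,

    and C > 0, since otherwise f would vanish almost everywhere and could not
    have total mass 1. Everything thus reduces to the behaviour of I, and
    monotonicity of a suitably weighted K_p takes the place of its
    asymptotics.

    If beta > 0, put b = sqrt beta and z = b sqrt s. The scaling
    w -> sqrt(s/beta) w turns I(s) into 2 (sqrt s / b)^p K_p(z), so that
    t^alpha f t is a constant times

      t^alpha e^(phi t - b sqrt s) (sqrt s)^q  *  B(z)

    for either choice (q, B) = (p, e^z K_p) or
    (q, B) = (p - 1/2, sqrt z e^z K_p). The first factor, called envelope
    below, has logarithmic derivative
    phi - b + (alpha + q)/t + O(1/t^2); hence it is eventually strictly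
    decreasing when phi < b, or when phi = b and alpha + q < 0
    ([envelope_decr]). It remains to see that B is nonincreasing.

    - e^z K_p(z) is always nonincreasing, because K_p is an integral of
      functions e^(-(z/2)(u + 1/u)) with u + 1/u >= 2
      ([expR_besselK_nincr]). As phi < b exactly when psi > 0 or phi < 0, this
      settles those two cases, for every alpha.

    - When psi = 0 < phi one has phi = b, and the decay can only come from the
      powers of t. The factor sqrt z must be absorbed into B to reach the sharp
      range alpha + p - 1/2 < 0, that is, alpha < 1 - lambda. The function
      sqrt z e^z K_p(z) is nonincreasing as soon as |p| >= 1/2
      ([sqrt_expR_besselK_nincr]), and |p| = 1/2 - lambda with lambda < 0. To
      see this, substitute r = sqrt z (x - 1/x), u = x^2, which turns the
      exponent into the z-independent Gaussian -r^2/2; folding r with -r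
      leaves the weight (x^2p + x^-2p)/(x + 1/x), x = x(r / sqrt z) >= 1, and
      this ratio is nondecreasing in x while x(r / sqrt z) decreases with z.

    If beta = 0, that is psi = phi = 0, scaling gives I(s) = s^p I(1), so f is
    a multiple of (chi + t^2)^p, and t^alpha (chi + t^2)^p is eventually
    strictly decreasing exactly when alpha + 2p < 0. *)

(** * Integration on the half line *)

(** No behaviour of F, F' or G at the endpoints is prescribed: the rule holds on
    each compact interval [1/n, n], and monotone convergence extends it to the
    half line. This matters because the integrands below have no continuous
    extension to 0 that could be read off their formulas. *)
Lemma ge0_integral_substitution_0y (R : realType) (i : interval R)
    (F F' G : R -> R) :
  (forall x y : R, 0 < x -> x < y -> F x < F y) ->
  (forall x : R, 0 < x -> is_derive x 1 F (F' x)) ->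
  (forall x : R, 0 < x -> {for x, continuous F'}) ->
  (forall x : R, 0 < x -> 0 <= F' x) ->
  (forall x : R, 0 < x -> F x \in i) ->
  (forall y : R, y \in i -> exists2 x : R, 0 < x & F x = y) ->
  {in i, continuous G} -> {in i, forall y : R, 0 <= G y} ->
  (\int[leb]_(y in [set` i]) (G y)%:E =
   \int[leb]_(x in `]0%R, +oo[) (G (F x) * F' x)%:E)%E.
Proof.
move=> incF dF cF' F'0 Fi iF cG G0.
pose a (n : nat) : R := n.+1%:R^-1; pose b (n : nat) : R := n.+1%:R.
have a0 n : 0 < a n by rewrite invr_gt0 ltr0n.
have ab n : a n <= b n.
  by rewrite /a /b (@le_trans _ _ 1)// ?invf_le1 ?ler1n ?ltr0n.
have na m n : (m <= n)%N -> a n <= a m.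
  by move=> mn; rewrite lef_pV2 ?posrE ?ltr0n// ler_nat.
have nb m n : (m <= n)%N -> b m <= b n by move=> mn; rewrite ler_nat.
have leF x y : 0 < x -> x <= y -> F x <= F y.
  by move=> x0; rewrite le_eqVlt => /predU1P[->//|/(incF _ _ x0)/ltW].
have abi x n : x \in `[a n, b n] -> 0 < x.
  by rewrite in_itv/= => /andP[+ _]; exact: lt_le_trans.
have Fabi n y : y \in `[F (a n), F (b n)] -> y \in i.
  rewrite in_itv/= => /andP[ay yb].
  have := @interval_is_interval _ i (F (a n)) (F (b n)); apply => //.
  - exact: Fi.
  - exact/Fi/(lt_le_trans (a0 n)).
  - by apply/andP.
have iU : [set` i] = \bigcup_n `[F (a n), F (b n)]%classic.
  apply/seteqP; split => [y /= /iF[x x0 <-]|y [n _ /=]]; last exact: Fabi.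
  pose n := maxn (Num.trunc x) (Num.trunc x^-1).
  exists n => //=; rewrite in_itv/=; apply/andP; split.
    apply: leF => //; rewrite /a invf_ple ?posrE ?ltr0n//.
    apply: (le_trans (ltW (truncnS_gt _))); rewrite ler_nat ltnS.
    exact: leq_maxr.
  apply: leF => //; apply: (le_trans (ltW (truncnS_gt _))).
  by rewrite ler_nat ltnS leq_maxl.
have zU : `]0%R, +oo[%classic = \bigcup_n `[a n, b n]%classic.
  apply/seteqP; split => [x /=|y [n _ /=]]; last first.
    by move/abi; rewrite in_itv/= andbT.
  rewrite in_itv/= andbT => x0.
  pose n := maxn (Num.trunc x) (Num.trunc x^-1).
  exists n => //=; rewrite in_itv/=; apply/andP; split.
    rewrite /a invf_ple ?posrE ?ltr0n//.
    apply: (le_trans (ltW (truncnS_gt _))); rewrite ler_nat ltnS.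
    exact: leq_maxr.
  apply: (le_trans (ltW (truncnS_gt _))).
  by rewrite ler_nat ltnS leq_maxl.
have F'E x : 0 < x -> F^`()%classic x = F' x.
  by move=> x0; rewrite derive1E; have ? := dF _ x0; exact: derive_val.
have cdF x : 0 < x -> {for x, continuous F^`()%classic}.
  move=> x0; rewrite /prop_for /continuous_at F'E//.
  apply: cvg_trans (cF' _ x0); apply: near_eq_cvg.
  near=> z; apply/esym/F'E; near: z; exact: lt_nbhsr.
have cF x : 0 < x -> {for x, continuous F}.
  by move=> /dF[/derivable1_diffP/differentiable_continuous].
have mG n : measurable_fun `[F (a n), F (b n)] G.
  apply: subspace_continuous_measurable_fun => //.
  by apply: continuous_in_subspaceT => y /set_mem /Fabi; exact: cG.
have mGF n : measurable_fun `[a n, b n] (fun x => G (F x) * F' x).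
  apply: subspace_continuous_measurable_fun => //.
  apply: continuous_in_subspaceT => x /set_mem /abi x0.
  apply: continuousM; last exact: cF'.
  by apply: continuous_comp; [exact: cF|exact/cG/Fi].
have cG_ : (\int[leb]_(y in `[F (a n), F (b n)]) (G y)%:E)%E @[n --> \oo] -->
    (\int[leb]_(y in [set` i]) (G y)%:E)%E.
  rewrite iU; apply: ge0_nondecreasing_set_cvg_integral => //.
  - move=> m n mn; apply/subsetPset; apply: subset_itvScc.
      by apply: leF => //; exact: na.
    by apply: leF; [exact: lt_le_trans (ab m)|exact: nb].
  - by move=> n; apply/measurable_EFinP; exact: mG.
  - by move=> n x /Fabi/G0; rewrite lee_fin.
have cGF_ : (\int[leb]_(x in `[a n, b n]) (G (F x) * F' x)%:E)%E @[n --> \oo] -->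
    (\int[leb]_(x in `]0%R, +oo[) (G (F x) * F' x)%:E)%E.
  rewrite zU; apply: ge0_nondecreasing_set_cvg_integral => //.
  - move=> m n mn; apply/subsetPset; apply: subset_itvScc => //.
      exact: na.
    exact: nb.
  - by move=> n; apply/measurable_EFinP; exact: mGF.
  - move=> n x /abi x0; rewrite lee_fin mulr_ge0//; last exact: F'0.
    exact/G0/Fi.
suff E n : (\int[leb]_(y in `[F (a n), F (b n)]) (G y)%:E =
    \int[leb]_(x in `[a n, b n]) (G (F x) * F' x)%:E)%E.
  move: cG_; under eq_fun do rewrite E.
  by move=> cG_; exact: (cvg_unique _ cG_ cGF_).
rewrite integration_by_substitution_increasing//.
- by apply: eq_integral => x /set_mem /abi x0; rewrite mulrfctE /= F'E.
- by move=> x y /abi x0 _; exact: incF.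
- by move=> x /subset_itv_oo_cc /abi; exact: cdF.
- exact: (cvgP _ (cvg_at_right_filter (cdF _ (a0 n)))).
- exact: (cvgP _ (cvg_at_left_filter (cdF _ (lt_le_trans (a0 n) (ab n))))).
- split.
  + by move=> x /subset_itv_oo_cc /abi /dF[].
  + by apply: cvg_at_right_filter; exact: cF.
  + by apply: cvg_at_left_filter; apply: cF; exact: lt_le_trans (ab n).
- by apply: continuous_in_subspaceT => y /set_mem /Fabi; exact: cG.
Unshelve. all: end_near. Qed.

Lemma Rintegral_gt0 d (T : measurableType d) (R : realType)
    (mu : {measure set T -> \bar R}) (D : set T) (f : T -> R) :
  measurable D -> (0 < mu D)%E -> mu.-integrable D (EFin \o f) ->
  (forall x, D x -> 0 < f x) -> 0 < \int[mu]_(x in D) f x.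
Proof.
move=> mD muD intf f0; have f0' x : D x -> 0 <= f x by move/f0/ltW.
rewrite lt_neqAle Rintegral_ge0// andbT; apply/eqP => /esym If0.
have : (\int[mu]_(x in D) `|(f x)%:E| = 0)%E.
  under eq_integral => x /set_mem Dx do rewrite gee0_abs ?lee_fin ?f0'//.
  by rewrite -[LHS]fineK ?[X in X%:E]If0//; exact: integrable_fin_num.
move/(ae_eq_integral_abs _ mD (measurable_int mu intf)) => [N [mN N0 DN]].
move: muD; rewrite ltNge -N0 le_measure ?inE// => x Dx.
by apply: DN => /= /(_ Dx)[fx0]; move: (f0 _ Dx); rewrite fx0 ltxx.
Qed.

(** An infinite integral has real value 0, which multiplication by k preserves;
    this covers the divergent case of a nonnegative integrand. *)
Lemma ge0_RintegralZl d (T : measurableType d) (R : realType)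
    (mu : {measure set T -> \bar R}) (D : set T) (f : T -> R) (k : R) :
  measurable D -> measurable_fun D f -> (forall x, D x -> 0 <= f x) -> 0 <= k ->
  \int[mu]_(x in D) (k * f x) = k * \int[mu]_(x in D) f x.
Proof.
move=> mD mf f0 k0; rewrite /Rintegral.
under eq_integral do rewrite EFinM.
rewrite ge0_integralZl_EFin//; last exact/measurable_EFinP.
have : (0 <= \int[mu]_(x in D) (f x)%:E)%E by exact: integral_ge0.
case: (\int[mu]_(x in D) (f x)%:E)%E => [r _|_|//]; first by rewrite -EFinM.
move: k0; rewrite le_eqVlt => /predU1P[<-|k0]; first by rewrite mul0e mul0r.
by rewrite gt0_muley ?lte_fin//= mulr0.
Qed.

Lemma continuous_comp_opp (R : realType) (f : R -> R) :
  continuous f -> continuous (fun r : R => f (- r)).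
Proof.
move=> cf r; have cN : - s @[s --> r] --> - r by apply: cvgN; exact: cvg_id.
exact: (cvg_comp _ _ cN (cf (- r))).
Qed.

Lemma ge0_integral_fold (R : realType) (f : R -> R) :
  continuous f -> (forall r, 0 <= f r) ->
  (\int[leb]_(r in [set: R]) (f r)%:E =
   \int[leb]_(r in `]0%R, +oo[) (f r + f (- r))%:E)%E.
Proof.
move=> cf f0.
have mf : measurable_fun [set: R] (EFin \o f).
  by apply/measurable_EFinP; exact: continuous_measurable_fun.
have mfN : measurable_fun [set: R] (fun r => (f (- r))%:E).
  apply/measurable_EFinP; apply: continuous_measurable_fun.
  exact: continuous_comp_opp.
rewrite -(setUv `]-oo, (0 : R)]%classic) setCitvl ge0_integral_setU//=; last 3 first.
- by apply: measurable_funS mf.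
- by move=> r _; rewrite lee_fin.
- apply/disj_set2P; rewrite -subset0 => r [] /=; rewrite !in_itv/= andbT.
  by move=> r0; rewrite ltNge r0.
under [RHS]eq_integral do rewrite EFinD.
rewrite ge0_integralD//=; last 4 first.
- by move=> r _; rewrite lee_fin.
- exact: measurable_funS mf.
- by move=> r _; rewrite lee_fin.
- exact: measurable_funS mfN.
rewrite addeC; congr (_ + _)%E.
rewrite integral_itv_obnd_cbnd; last exact: measurable_funS mfN.
rewrite (ge0_integration_by_substitution0 mfN); last by move=> r; rewrite lee_fin.
by apply: eq_integral => r _; rewrite opprK.
Qed.

(** * Real powers *)

Lemma continuous_powR (R : realType) (a x : R) : 0 < x ->
  {for x, continuous (fun y : R => y `^ a)}.
Proof.
move=> x0; apply/differentiable_continuous/derivable1_diffP.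
by have [] := is_derive1_powR a x0.
Qed.

Lemma powR_predM (R : realType) (x a : R) : 0 < x -> x `^ a = x `^ (a - 1) * x.
Proof.
move=> x0; rewrite -{3}(powRr1 (ltW x0)) -powRD ?subrK//.
by rewrite (gt_eqF x0) implybT.
Qed.

Lemma powR_V (R : realType) (x a : R) : 0 < x -> x^-1 `^ a = x `^ (- a).
Proof. by move=> x0; rewrite -(powR_inv1 (ltW x0)) -powRrM mulN1r. Qed.

Lemma powR_le_addV_exp (R : realType) (a w : R) (n : nat) :
  0 < w -> `|a| <= n%:R -> w `^ a <= (w + w^-1) ^+ n.
Proof.
rewrite ler_norml => w0 /andP[na an].
have V0 : 0 < w^-1 by rewrite invr_gt0.
have [w1|w1] := leP 1 w.
  apply: (le_trans (ler_powR w1 an)); rewrite (powR_mulrn _ (ltW w0)).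
  by apply: lerXn2r; rewrite ?nnegrE ?addr_ge0 ?lerDl ?ltW.
have -> : w `^ a = w^-1 `^ (- a).
  by rewrite -(powR_inv1 (ltW w0)) -powRrM mulN1r opprK.
have V1 : 1 <= w^-1 by rewrite invf_ge1 ?(ltW w1).
have na' : - a <= n%:R by rewrite lerNl.
apply: (le_trans (ler_powR V1 na')); rewrite (powR_mulrn _ (ltW V0)).
by apply: lerXn2r; rewrite ?nnegrE ?addr_ge0 ?lerDr ?ltW.
Qed.

(** * The generalized inverse Gaussian integral and the Bessel function *)

(** The unnormalised generalized inverse Gaussian density. *)
Definition gig_kernel {R : realType} (p s b w : R) : R :=
  w `^ (p - 1) * expR (- (s / w + b * w) / 2).

Definition gig_integral {R : realType} (p s b : R) : R :=
  \int[leb]_(w in `]0, +oo[) gig_kernel p s b w.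

Lemma gig_kernel_ge0 (R : realType) (p s b w : R) : 0 <= gig_kernel p s b w.
Proof. by rewrite mulr_ge0 ?powR_ge0 ?expR_ge0. Qed.

Lemma gig_kernel_gt0 (R : realType) (p s b w : R) :
  0 < w -> 0 < gig_kernel p s b w.
Proof. by move=> w0; rewrite mulr_gt0 ?powR_gt0 ?expR_gt0. Qed.

Lemma gig_kernel_continuous (R : realType) (p s b w : R) : 0 < w ->
  {for w, continuous (gig_kernel p s b)}.
Proof.
move=> w0; apply: continuousM; first exact: continuous_powR.
apply: continuous_comp; last exact: continuous_expR.
apply: continuousM; last exact: cst_continuous.
apply: (@continuousN _ R^o); apply: (@continuousD _ R^o).
  apply: continuousM; first exact: cst_continuous.
  by apply: inv_continuous; rewrite gt_eqF.
by apply: continuousM => //; exact: cst_continuous.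
Qed.

Lemma gig_kernel_measurable (R : realType) (p s b : R) :
  measurable_fun (`]0, +oo[ : set R) (gig_kernel p s b).
Proof.
apply: open_continuous_measurable_fun; first exact: interval_open.
move=> w; rewrite inE/= in_itv/= andbT; exact: gig_kernel_continuous.
Qed.

(** With c = min(s, b)/4 the exponential is at most exp(-2c(w + 1/w)). One half,
    exp(-c(w + 1/w)), absorbs the power w^(p-1), which is at most (w + 1/w)^n;
    the other half is dominated by a multiple of the exponential density of
    rate c. *)
Lemma gig_kernel_integrable (R : realType) (p s b : R) : 0 < s -> 0 < b ->
  leb.-integrable (`]0, +oo[ : set R) (EFin \o gig_kernel p s b).
Proof.
move=> s0 b0; pose c := Num.min s b / 4.
have c0 : 0 < c by rewrite divr_gt0// lt_min s0 b0.
have cs : 4 * c <= s by rewrite /c mulrCA divff// mulr1 ge_min lexx.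
have cb : 4 * c <= b by rewrite /c mulrCA divff// mulr1 ge_min lexx orbT.
pose n := (Num.trunc `|p - 1|).
pose M := n.+1`!%:R / c ^+ n.+1.
have le_kernel w : 0 < w -> gig_kernel p s b w <= M * expR (- c * w).
  move=> w0; have V0 : 0 < w^-1 by rewrite invr_gt0.
  have wV0 : 0 < w + w^-1 by rewrite addr_gt0.
  have step1 : w `^ (p - 1) <= M * expR (c * (w + w^-1)).
    have pn : `|p - 1| <= n.+1%:R by rewrite ltW// truncnS_gt.
    apply: (le_trans (powR_le_addV_exp w0 pn)).
    have : (c * (w + w^-1)) ^+ n.+1 / n.+1`!%:R <= expR (c * (w + w^-1)).
      by apply: le_trans (expR_ge1Dxn n (ltW (mulr_gt0 c0 wV0))); rewrite lerDr.
    rewrite exprMn ler_pdivrMr ?ltr0n ?fact_gt0// => le_exp.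
    by rewrite /M mulrAC ler_pdivlMr ?exprn_gt0// mulrC [leRHS]mulrC.
  rewrite /gig_kernel (le_trans (ler_wpM2r (expR_ge0 _) step1))//.
  rewrite -mulrA -expRD; apply: ler_wpM2l; last rewrite ler_expR.
  - by rewrite divr_ge0 ?exprn_ge0// ltW.
  - have := ler_wpM2r (ltW V0) cs; have := ler_wpM2r (ltW w0) cb.
    have := mulr_gt0 c0 V0; lra.
have int_exp : leb.-integrable (`]0, +oo[ : set R)
    (fun w => ((M / c)%:E * (exponential_pdf c w)%:E)%E).
  apply: integrableZl => //; apply: integrableS (integrable_exponential_pdf _) => //.
apply: le_integrable int_exp => //.
  by apply/measurable_EFinP; exact: gig_kernel_measurable.
move=> w; rewrite /= in_itv/= andbT => w0.
have M0 : 0 <= M by rewrite divr_ge0 ?exprn_ge0// ltW.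
rewrite exponential_pdfE ?(ltW w0)// lee_fin.
rewrite !ger0_norm ?gig_kernel_ge0//.
  by rewrite mulrA mulfVK ?gt_eqF// le_kernel.
by apply: mulr_ge0; [exact: divr_ge0 M0 (ltW c0)|exact: mulr_ge0 (ltW c0) (expR_ge0 _)].
Qed.

Lemma gig_integral_ge0 (R : realType) (p s b : R) : 0 <= gig_integral p s b.
Proof. by apply: Rintegral_ge0 => w _; exact: gig_kernel_ge0. Qed.

Lemma besselKE (R : realType) (nu x : R) :
  besselK nu x = 2^-1 * gig_integral nu x x.
Proof.
rewrite /besselK; congr (_ * _); apply: eq_Rintegral => u _.
by rewrite /gig_kernel; congr (_ * expR _); ring.
Qed.

Lemma besselK_ge0 (R : realType) (p z : R) : 0 <= besselK p z.
Proof.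
rewrite besselKE mulr_ge0// Rintegral_ge0// => w _; exact: gig_kernel_ge0.
Qed.

Lemma besselK_gt0 (R : realType) (p z : R) : 0 < z -> 0 < besselK p z.
Proof.
move=> z0; rewrite besselKE mulr_gt0// Rintegral_gt0//=.
  by rewrite lebesgue_measure_itv/= ltry ltry.
- exact: gig_kernel_integrable.
- by move=> w /=; rewrite in_itv/= andbT; exact: gig_kernel_gt0.
Qed.

(** Dominated convergence for parameters in (z/2, z + 1), where the kernel is
    largest at z/2. *)
Lemma besselK_continuous (R : realType) (p z : R) : 0 < z ->
  {for z, continuous (besselK p)}.
Proof.
move=> z0; rewrite (_ : besselK p = fun x => 2^-1 * gig_integral p x x); last first.
  by apply/funext => x; rewrite besselKE.
apply: continuousM; first exact: cst_continuous.
have h0 : 0 < z / 2 by rewrite divr_gt0.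
have itvP x : `](z / 2), (z + 1)[%classic x -> z / 2 <= x.
  by rewrite /= in_itv/= => /andP[/ltW].
have c_kernel w : continuous (fun l : R => gig_kernel p l l w).
  rewrite /gig_kernel => x; apply: cvgM; first exact: cvg_cst.
  apply: continuous_cvg; first exact: continuous_expR.
  apply: cvgM; last exact: cvg_cst.
  by apply: cvgN; apply: cvgD; apply: cvgM; (exact: cvg_id || exact: cvg_cst).
apply: (@continuity_under_integral R _ _ leb (fun x w => gig_kernel p x x w)
  `]0, +oo[ _ (z / 2) (z + 1) _ _ (gig_kernel p (z / 2) (z / 2))) => //.
- by move=> x /itvP hx; apply: gig_kernel_integrable; exact: lt_le_trans hx.
- by apply/aeW => w _ x _; exact: c_kernel.
- exact: gig_kernel_integrable.
- move=> x /itvP hx; apply/aeW => w; rewrite /= in_itv/= andbT => w0.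
  rewrite ger0_norm ?gig_kernel_ge0// ler_wpM2l ?powR_ge0// ler_expR.
  have V0 : 0 < w^-1 by rewrite invr_gt0.
  have := ler_wpM2r (ltW V0) hx; have := ler_wpM2r (ltW w0) hx; lra.
- by rewrite inE/= in_itv/=; apply/andP; split; lra.
Qed.

(** Under the integral, e^z contributes to the exponent -(z/2)(w + 1/w - 2),
    whose second factor is nonnegative. *)
Lemma expR_besselK_nincr (R : realType) (p x y : R) : 0 < x -> x <= y ->
  expR y * besselK p y <= expR x * besselK p x.
Proof.
move=> x0 xy; have y0 : 0 < y := lt_le_trans x0 xy.
have int z : 0 < z -> leb.-integrable (`]0, +oo[ : set R)
    (EFin \o (fun w => expR z * gig_kernel p z z w)).
  move=> z0; rewrite (_ : _ \o _ = (fun w => (expR z)%:E * (gig_kernel p z z w)%:E)%E).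
    by apply: integrableZl => //; exact: gig_kernel_integrable.
  by apply/funext => w /=; rewrite EFinM.
rewrite !besselKE ![expR _ * _]mulrCA ler_wpM2l//.
rewrite -!RintegralZl//; [|exact: gig_kernel_integrable..].
apply: le_Rintegral => //; [exact: int..|].
move=> w; rewrite /= in_itv/= andbT => w0.
rewrite /gig_kernel !(mulrCA (expR _)) ler_wpM2l ?powR_ge0// -!expRD ler_expR.
have wV2 : 0 <= w + w^-1 - 2.
  rewrite (_ : _ - _ = (w - 1) ^+ 2 / w) ?divr_ge0 ?sqr_ge0 ?ltW//.
  by field; rewrite gt_eqF.
have := ler_wpM2r wV2 xy; lra.
Qed.

(** The substitution w -> c w. *)
Lemma gig_integral_scale (R : realType) (p s b c : R) : 0 < c ->
  gig_integral p s b = c `^ p * gig_integral p (s / c) (b * c).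
Proof.
move=> c0.
have itv0y (x : R) : (x \in `]0, +oo[) = (0 < x) by rewrite in_itv/= andbT.
rewrite -ge0_RintegralZl//; last 3 first.
- exact: gig_kernel_measurable.
- by move=> x _; exact: gig_kernel_ge0.
- exact: powR_ge0.
congr fine.
apply: etrans; first apply: (@ge0_integral_substitution_0y R `]0, +oo[
  (fun x => c * x) (fun=> c) (gig_kernel p s b)).
- by move=> x y _ xy; rewrite ltr_pM2l.
- by move=> x _; apply: is_derive_eq; rewrite /GRing.scale/= mulr1.
- by move=> x _; exact: cst_continuous.
- by move=> x _; exact: ltW.
- by move=> x x0; rewrite itv0y mulr_gt0.
- move=> y; rewrite itv0y => y0; exists (y / c); first by rewrite divr_gt0.
  by rewrite mulrCA divff ?mulr1// gt_eqF.
- by move=> y; rewrite itv0y; exact: gig_kernel_continuous.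
- by move=> y _; exact: gig_kernel_ge0.
apply: eq_integral => w; rewrite inE/= itv0y => w0; congr EFin.
rewrite /gig_kernel powRM ?ltW// (powR_predM p c0).
rewrite (_ : - (s / (c * w) + b * (c * w)) / 2 = - (s / c / w + b * c * w) / 2).
  by ring.
by rewrite invfM; ring.
Qed.

(** Scaling by c = sqrt(s/b) equalises the two coefficients in the exponent. *)
Lemma gig_integralE (R : realType) (p s b : R) : 0 < s -> 0 < b ->
  gig_integral p s b =
  Num.sqrt (s / b) `^ p * (2 * besselK p (Num.sqrt (s * b))).
Proof.
move=> s0 b0; have sb0 : 0 < Num.sqrt (s / b) by rewrite sqrtr_gt0 divr_gt0.
have s2 := sqr_sqrtr (ltW s0); have b2 := sqr_sqrtr (ltW b0).
have s'0 : Num.sqrt s != 0 by rewrite gt_eqF ?sqrtr_gt0.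
have b'0 : Num.sqrt b != 0 by rewrite gt_eqF ?sqrtr_gt0.
have sE : s / Num.sqrt (s / b) = Num.sqrt (s * b).
  rewrite (sqrtrM _ (ltW s0)) (sqrtrM _ (ltW s0)) (sqrtrV (ltW b0)).
  by rewrite -{1}s2; field; rewrite s'0 b'0.
have bE : b * Num.sqrt (s / b) = Num.sqrt (s * b).
  rewrite (sqrtrM _ (ltW s0)) (sqrtrM _ (ltW s0)) (sqrtrV (ltW b0)).
  by rewrite -{1}b2; field; rewrite b'0.
by rewrite (gig_integral_scale _ _ _ sb0) sE bE besselKE mulVKf.
Qed.

Lemma gig_integral0E (R : realType) (p s : R) : 0 < s ->
  gig_integral p s 0 = s `^ p * gig_integral p 1 0.
Proof.
by move=> s0; rewrite (gig_integral_scale _ _ _ s0) mul0r divff// gt_eqF.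
Qed.

Lemma gig_integral_continuous (R : realType) (p s b : R) : 0 < s -> 0 <= b ->
  {for s, continuous (fun s => gig_integral p s b)}.
Proof.
move=> s0 b0; have near_pos : \forall x \near s, 0 < x by exact: lt_nbhsr.
move: b0; rewrite le_eqVlt => /predU1P[<-|b0].
  rewrite /prop_for /continuous_at gig_integral0E//.
  apply: cvg_trans; first apply: near_eq_cvg.
    by near=> x; rewrite gig_integral0E//; near: x.
  by apply: cvgM; [exact: continuous_powR|exact: cvg_cst].
rewrite /prop_for /continuous_at gig_integralE//.
have z0 : 0 < Num.sqrt (s * b) by rewrite sqrtr_gt0 mulr_gt0.
have y0 : 0 < Num.sqrt (s / b) by rewrite sqrtr_gt0 divr_gt0.
apply: cvg_trans; first apply: near_eq_cvg.
  by near=> x; rewrite gig_integralE//; near: x.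
apply: cvgM.
  apply: (@cvg_comp _ _ _ (fun x : R => Num.sqrt (x / b)) (fun y => y `^ p)
    _ (nbhs (Num.sqrt (s / b)))); last exact: continuous_powR.
  apply: continuous_cvg; first exact: sqrt_continuous.
  by apply: cvgM; [exact: cvg_id|exact: cvg_cst].
apply: cvgM; first exact: cvg_cst.
apply: (@cvg_comp _ _ _ (fun x : R => Num.sqrt (x * b)) (besselK p)
    _ (nbhs (Num.sqrt (s * b)))); last exact: besselK_continuous.
apply: continuous_cvg; first exact: sqrt_continuous.
by apply: cvgM; [exact: cvg_id|exact: cvg_cst].
Unshelve. all: end_near. Qed.

(** * Monotonicity of a ratio of hyperbolic cosines *)

Lemma le_addV (R : realType) (s t : R) : 0 < s -> s <= t -> s^-1 <= t ->
  s + s^-1 <= t + t^-1.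
Proof.
move=> s0 st Vst; have t0 := lt_le_trans s0 st.
rewrite -subr_ge0 (_ : _ - _ = (t - s) * (t - s^-1) / t).
  by rewrite divr_ge0 ?mulr_ge0 ?subr_ge0// ltW.
by field; rewrite !gt_eqF.
Qed.

(** With u = x^(a-1) and v = y^(a-1), this says that cosh(a X)/cosh(X)
    increases with X >= 0 when a >= 1. As in the product formula for cosh, each
    product splits into two terms s + 1/s; each value of s on the
    right dominates the matching one on the left as well as its inverse. *)
Lemma le_addV_ratio (R : realType) (u v x y : R) :
  1 <= u -> u <= v -> 1 <= x -> x <= y ->
  (u * x + (u * x)^-1) * (y + y^-1) <= (v * y + (v * y)^-1) * (x + x^-1).
Proof.
move=> u1 uv x1 xy.
have u0 := lt_le_trans ltr01 u1; have v0 := lt_le_trans u0 uv.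
have x0 := lt_le_trans ltr01 x1; have y0 := lt_le_trans x0 xy.
have expand (a b : R) : 0 < a -> 0 < b -> (a + a^-1) * (b + b^-1) =
    (a * b + (a * b)^-1) + (a / b + (a / b)^-1).
  by move=> a0 b0; field; rewrite !gt_eqF.
rewrite !expand ?mulr_gt0// lerD// le_addV ?divr_gt0 ?mulr_gt0//.
- by rewrite mulrAC ler_pM2r// ler_pM2r.
- rewrite (@le_trans _ _ 1)//.
    by rewrite invf_le1 ?mulr_gt0// !mulr_ege1// (le_trans x1).
  exact: mulr_ege1 (mulr_ege1 (le_trans u1 uv) (le_trans x1 xy)) x1.
- rewrite ler_pdivrMr// mulrAC ler_pdivlMr// -!mulrA.
  by rewrite ler_pM ?mulr_ge0 ?ler_pM// ltW.
- rewrite invf_div ler_pdivrMr ?mulr_gt0// mulrAC ler_pdivlMr//.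
  rewrite (_ : _ * (u * x) = (v * u) * (y * x)); last by ring.
  apply: ler_peMl; first by rewrite mulr_ge0 ?(ltW x0, ltW y0).
  exact: mulr_ege1 (le_trans u1 uv) u1.
Qed.

Lemma powR_addV_ratio (R : realType) (a x y : R) :
  1 <= `|a| -> 1 <= x -> x <= y ->
  (x `^ a + x `^ (- a)) / (x + x^-1) <= (y `^ a + y `^ (- a)) / (y + y^-1).
Proof.
wlog a0 : a / 0 <= a => [hw a1 x1 xy|].
  have [/hw|/ltW a0] := leP 0 a; first exact.
  have := hw (- a); rewrite oppr_ge0 normrN opprK => /(_ a0 a1 x1 xy).
  by rewrite (addrC (x `^ a)) (addrC (y `^ a)).
rewrite ger0_norm// => a1 x1 xy.
have x0 := lt_le_trans ltr01 x1; have y0 := lt_le_trans x0 xy.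
have split z : 0 < z -> z `^ a + z `^ (- a) =
    z `^ (a - 1) * z + (z `^ (a - 1) * z)^-1.
  by move=> z0; rewrite powRN -powR_predM.
rewrite ler_pdivrMr ?addr_gt0 ?invr_gt0// mulrAC ler_pdivlMr ?addr_gt0 ?invr_gt0//.
rewrite !split//; apply: le_addV_ratio => //.
  have /(ler_powR x1) : 0 <= a - 1 by rewrite subr_ge0.
  by rewrite powRr0.
by apply: ge0_ler_powR; rewrite ?nnegrE ?subr_ge0 ?(ltW x0) ?(ltW y0).
Qed.

(** * Hyperbolic substitution in the Bessel integral *)

(** The inverse of x -> x - 1/x on the positive half line. *)
Definition subV_inv {R : realType} (q : R) : R := (q + Num.sqrt (q ^+ 2 + 4)) / 2.

Lemma subV_inv_gt0 (R : realType) (q : R) : 0 < subV_inv q.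
Proof.
have q4 : 0 < q ^+ 2 + 4 by rewrite ltr_wpDl ?sqr_ge0.
have := sqr_sqrtr (ltW q4); have : 0 < Num.sqrt (q ^+ 2 + 4) by rewrite sqrtr_gt0.
rewrite /subV_inv; move: (Num.sqrt _) => d d0 d2.
by rewrite divr_gt0// ltNge; apply/negP => ?; nra.
Qed.

Lemma subV_invN (R : realType) (q : R) : subV_inv (- q) = (subV_inv q)^-1.
Proof.
have q4 : 0 < q ^+ 2 + 4 by rewrite ltr_wpDl ?sqr_ge0.
apply: (mulfI (lt0r_neq0 (subV_inv_gt0 q))); rewrite divff; last first.
  exact: lt0r_neq0 (subV_inv_gt0 q).
have := sqr_sqrtr (ltW q4); rewrite /subV_inv sqrrN.
by move: (Num.sqrt _) => d d2; nra.
Qed.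

Lemma subV_inv_sub (R : realType) (q : R) : subV_inv q - (subV_inv q)^-1 = q.
Proof. by rewrite -subV_invN /subV_inv sqrrN; field. Qed.

Lemma subV_invK (R : realType) (x : R) : 0 < x -> subV_inv (x - x^-1) = x.
Proof.
move=> x0; rewrite /subV_inv (_ : _ + 4 = (x + x^-1) ^+ 2).
  by rewrite sqrtr_sqr ger0_norm ?addr_ge0 ?invr_ge0 ?(ltW x0)//; field; rewrite gt_eqF.
by field; rewrite gt_eqF.
Qed.

Lemma subV_inv_le (R : realType) (q r : R) : q <= r -> subV_inv q <= subV_inv r.
Proof.
move=> qr; rewrite leNgt; apply/negP => rq.
have := subV_inv_sub q; have := subV_inv_sub r.
have : (subV_inv q)^-1 < (subV_inv r)^-1.
  by rewrite ltf_pV2 ?posrE ?subV_inv_gt0.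
lra.
Qed.

Lemma subV_inv_ge1 (R : realType) (q : R) : 0 <= q -> 1 <= subV_inv q.
Proof. by move/subV_inv_le; rewrite -{1}(subrr 1) -{2}invr1 subV_invK. Qed.

Lemma subV_inv_continuous (R : realType) : continuous (@subV_inv R).
Proof.
move=> q; rewrite /subV_inv; apply: cvgM; last exact: cvg_cst.
apply: cvgD; first exact: cvg_id.
apply: continuous_cvg; first exact: sqrt_continuous.
apply: cvgD; last exact: cvg_cst.
by exact: exprn_continuous.
Qed.

(** The integrand of 2 sqrt z e^z K_p(z) after the substitution
    r = sqrt z (sqrt u - 1 / sqrt u), so that x below is sqrt u. In
    exponential coordinates u = e^(2y), r is 2 sqrt z sinh y and the exponent
    -z (cosh (2y) - 1) is -r^2/2. *)
Definition hyperbolic_integrand {R : realType} (p z r : R) : R :=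
  let x := subV_inv (r / Num.sqrt z) in
  expR (- (r ^+ 2 / 2)) * (2 * x `^ (2 * p) / (x + x^-1)).

Lemma hyperbolic_integrand_ge0 (R : realType) (p z r : R) :
  0 <= hyperbolic_integrand p z r.
Proof.
rewrite /hyperbolic_integrand /=; set x := subV_inv _.
have x0 : 0 <= x := ltW (subV_inv_gt0 _).
by rewrite mulr_ge0 ?expR_ge0// divr_ge0 ?mulr_ge0 ?powR_ge0 ?addr_ge0 ?invr_ge0.
Qed.

Lemma hyperbolic_integrand_continuous (R : realType) (p z : R) :
  continuous (hyperbolic_integrand p z).
Proof.
move=> r; rewrite /hyperbolic_integrand /=.
have x0 := subV_inv_gt0 (r / Num.sqrt z).
have cx : subV_inv (s / Num.sqrt z) @[s --> r] --> subV_inv (r / Num.sqrt z).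
  apply: continuous_cvg; first exact: subV_inv_continuous.
  by apply: cvgM; [exact: cvg_id|exact: cvg_cst].
apply: cvgM.
  apply: continuous_cvg; first exact: continuous_expR.
  by apply: cvgN; apply: cvgM; [exact: exprn_continuous|exact: cvg_cst].
apply: cvgM.
  apply: cvgM; first exact: cvg_cst.
  exact: (cvg_comp _ _ cx (@continuous_powR R (2 * p) _ x0)).
apply: cvgV; first by rewrite gt_eqF// addr_gt0 ?invr_gt0.
by apply: cvgD => //; apply: cvgV => //; rewrite gt_eqF.
Qed.

Lemma gig_integral_hyperbolic (R : realType) (p z : R) : 0 < z ->
  ((Num.sqrt z * (expR z * gig_integral p z z))%:E =
   \int[leb]_(r in [set: R]) (hyperbolic_integrand p z r)%:E)%E.
Proof.
move=> z0; have sz0 : 0 < Num.sqrt z by rewrite sqrtr_gt0.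
have sz2 := sqr_sqrtr (ltW z0).
pose F (u : R) : R := Num.sqrt z * (u `^ (2^-1) - u `^ (- 2^-1)).
pose F' (u : R) : R :=
  Num.sqrt z * (2^-1 * u `^ (2^-1 - 1) - (- 2^-1 * u `^ (- 2^-1 - 1))).
have FE u : F u = Num.sqrt z * (u `^ (2^-1) - (u `^ (2^-1))^-1).
  by rewrite /F powRN.
have FK u : 0 < u -> subV_inv (F u / Num.sqrt z) = u `^ (2^-1).
  move=> u0; rewrite FE mulrAC divff ?gt_eqF// mul1r subV_invK//.
  exact: powR_gt0.
apply: esym; rewrite -set_itvNyy.
apply: etrans; first apply: (@ge0_integral_substitution_0y R `]-oo, +oo[
  F F' (hyperbolic_integrand p z)).
- move=> x y x0 xy; rewrite !FE ltr_pM2l//.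
  have xy' : x `^ 2^-1 < y `^ 2^-1.
    apply: gt0_ltr_powR; rewrite ?invr_gt0 ?nnegrE ?(ltW x0)//.
    exact: ltW (lt_trans x0 xy).
  apply: ltrD => //; rewrite ltrN2 ltf_pV2 ?posrE ?powR_gt0//.
  exact: lt_trans xy.
- move=> x x0; have d1 := is_derive1_powR 2^-1 x0.
  have d2 := is_derive1_powR (- 2^-1) x0.
  exact: is_derive_eq.
- move=> x x0; apply: cvgM; first exact: cvg_cst.
  by apply: cvgB; apply: cvgM; (exact: cvg_cst || exact: continuous_powR).
- move=> x x0; rewrite mulr_ge0 ?(ltW sz0)// mulNr opprK.
  by rewrite addr_ge0 ?mulr_ge0 ?powR_ge0.
- by [].
- move=> y _; have x0 := subV_inv_gt0 (y / Num.sqrt z).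
  exists (subV_inv (y / Num.sqrt z) ^+ 2); first by rewrite exprn_gt0.
  rewrite FE -powR_mulrn ?(ltW x0)// -powRrM divff// powRr1 ?(ltW x0)//.
  by rewrite subV_inv_sub mulrC mulfVK ?gt_eqF.
- by move=> y _; exact: hyperbolic_integrand_continuous.
- by move=> y _; exact: hyperbolic_integrand_ge0.
rewrite mulrA /gig_integral -ge0_RintegralZl//; last 2 first.
- exact: gig_kernel_measurable.
- by move=> w _; exact: gig_kernel_ge0.
have int_kernel : leb.-integrable (`]0, +oo[ : set R)
    (EFin \o (fun w => Num.sqrt z * expR z * gig_kernel p z z w)).
  rewrite (_ : _ \o _ = (fun w =>
    (Num.sqrt z * expR z)%:E * (gig_kernel p z z w)%:E)%E).
    by apply: integrableZl => //; exact: gig_kernel_integrable.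
  by apply/funext => w /=; rewrite EFinM.
rewrite fineK; last exact: integrable_fin_num int_kernel.
apply: eq_integral => u; rewrite inE/= in_itv/= andbT => u0; congr EFin.
(* In terms of y = sqrt u every power involved becomes rational in y. *)
have y0 : 0 < u `^ 2^-1 by exact: powR_gt0.
have yu : (u `^ 2^-1) ^+ 2 = u.
  by rewrite -powR_mulrn ?powR_ge0// -powRrM mulVf// powRr1 ?ltW.
have yp : (u `^ 2^-1) `^ (2 * p) = u `^ (p - 1) * u.
  by rewrite -powRrM mulrA mulVf// mul1r powR_predM.
rewrite /hyperbolic_integrand /= FK// yp /F' /gig_kernel.
rewrite [u `^ (2^-1 - 1)]powRB ?(gt_eqF u0) ?implybT// powRr1 ?(ltW u0)//.
rewrite [u `^ (- 2^-1 - 1)]powRB ?(gt_eqF u0) ?implybT// powRr1 ?(ltW u0)//.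
have -> : expR (- (F u ^+ 2 / 2)) = expR z * expR (- (z / u + z * u) / 2).
  rewrite -expRD; congr expR; rewrite FE exprMn sz2.
  move: (u `^ 2^-1) y0 yu {yp} => y y0 yu.
  by rewrite -yu; field; rewrite gt_eqF.
rewrite powRN; move: (u `^ (2^-1)) y0 yu {yp} => y y0 yu.
move: (expR z) (expR _) (u `^ (p - 1)) (Num.sqrt z) => a b c e.
rewrite -yu; field; rewrite (gt_eqF y0) gt_eqF//.
by rewrite addr_gt0// mulr_gt0.
Qed.

(** The hyperbolic integrand depends on z only through r / sqrt z, but varies
    with z in opposite directions for r > 0 and r < 0. Folding the two halves
    together replaces x^(2p) by x^(2p) + x^(-2p) with x >= 1 decreasing in z,
    and the condition on p makes the folded integrand nondecreasing in x. *)
Lemma sqrt_expR_besselK_nincr (R : realType) (p x y : R) :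
  2^-1 <= `|p| -> 0 < x -> x <= y ->
  Num.sqrt y * (expR y * besselK p y) <= Num.sqrt x * (expR x * besselK p x).
Proof.
move=> p2 x0 xy; have y0 := lt_le_trans x0 xy.
have a1 : 1 <= `|2 * p|.
  by rewrite normrM ger0_norm//; lra.
have foldE z r : hyperbolic_integrand p z r + hyperbolic_integrand p z (- r) =
    2 * expR (- (r ^+ 2 / 2)) *
    ((subV_inv (r / Num.sqrt z) `^ (2 * p) + subV_inv (r / Num.sqrt z) `^ (- (2 * p)))
     / (subV_inv (r / Num.sqrt z) + (subV_inv (r / Num.sqrt z))^-1)).
  rewrite /hyperbolic_integrand /= sqrrN mulNr subV_invN invrK.
  rewrite (powR_V _ (subV_inv_gt0 _)); set w := subV_inv _.
  by rewrite (addrC w^-1 w); ring.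
have besselKE' z : Num.sqrt z * (expR z * besselK p z) =
    2^-1 * (Num.sqrt z * (expR z * gig_integral p z z)) by rewrite besselKE; ring.
rewrite !besselKE' ler_pM2l ?invr_gt0 ?ltr0n//.
rewrite -lee_fin (gig_integral_hyperbolic p x0) (gig_integral_hyperbolic p y0).
rewrite !ge0_integral_fold; last 4 first.
- exact: hyperbolic_integrand_continuous.
- exact: hyperbolic_integrand_ge0.
- exact: hyperbolic_integrand_continuous.
- exact: hyperbolic_integrand_ge0.
have mh z : measurable_fun (`]0, +oo[ : set R) (fun r =>
    (hyperbolic_integrand p z r + hyperbolic_integrand p z (- r))%:E).
  apply/measurable_EFinP; apply: measurable_funTS.
  apply: continuous_measurable_fun => r.
  apply: cvgD; first exact: hyperbolic_integrand_continuous.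
  exact: continuous_comp_opp (@hyperbolic_integrand_continuous R p z) r.
apply: ge0_le_integral => //.
- by move=> r _; rewrite lee_fin addr_ge0 ?hyperbolic_integrand_ge0.
- exact: mh.
- exact: mh.
- move=> r /=; rewrite in_itv/= andbT => r0; rewrite lee_fin !foldE.
  have sx0 : 0 < Num.sqrt x by rewrite sqrtr_gt0.
  have sy0 : 0 < Num.sqrt y by rewrite sqrtr_gt0.
  apply: ler_wpM2l; first by rewrite mulr_ge0 ?expR_ge0.
  apply: powR_addV_ratio => //.
    by rewrite subV_inv_ge1// divr_ge0 ?(ltW r0)// (ltW sy0).
  apply: subV_inv_le; rewrite ler_pM2l// lef_pV2 ?posrE//.
  by rewrite ler_wsqrtr.
Qed.

(** * The elementary envelope *)

(** The elementary factor of t^a f(t), once a monotone multiple of a Bessel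
    function has been split off. *)
Definition envelope {R : realType} (a phi b chi q t : R) : R :=
  t `^ a * expR (phi * t - b * Num.sqrt (chi + t ^+ 2)) *
  Num.sqrt (chi + t ^+ 2) `^ q.

Lemma envelope_gt0 (R : realType) (a phi b chi q t : R) : 0 <= chi -> 0 < t ->
  0 < envelope a phi b chi q t.
Proof.
move=> chi0 t0; rewrite !mulr_gt0 ?expR_gt0 ?powR_gt0// sqrtr_gt0.
by rewrite ltr_wpDl ?exprn_gt0.
Qed.

(** The left-hand side is the logarithmic derivative of the envelope. The error
    term comes from sqrt(chi + t^2) being t up to a relative error of at most
    chi / t^2. *)
Lemma log_envelope_derive_le (R : realType) (a phi b chi q t : R) :
  0 <= chi -> 1 <= t ->
  a / t + (phi - b * (t / Num.sqrt (chi + t ^+ 2))) + q * (t / (chi + t ^+ 2))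
  <= phi - b + (a + q) / t + (`|b| + `|q|) * chi / t ^+ 2.
Proof.
move=> chi0 t1; have t0 : 0 < t := lt_le_trans ltr01 t1.
have s0 : 0 < chi + t ^+ 2 by rewrite ltr_wpDl ?exprn_gt0.
have := sqr_sqrtr (ltW s0); have : 0 < Num.sqrt (chi + t ^+ 2) by rewrite sqrtr_gt0.
move: (Num.sqrt _) => r r0 r2.
have tr : t <= r by rewrite leNgt; apply/negP => ?; nra.
have e1 : 1 - t / r = chi / (r * (r + t)).
  have -> : chi = r ^+ 2 - t ^+ 2 by rewrite r2 addrK.
  by field; rewrite !gt_eqF// addr_gt0.
have e2 : t / (chi + t ^+ 2) = t^-1 - chi / (t * (chi + t ^+ 2)).
  by field; rewrite !gt_eqF.
have b1 : b * (1 - t / r) <= `|b| * (chi / t ^+ 2).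
  rewrite e1; apply: le_trans (ler_wpM2r _ (ler_norm b)) _.
    by rewrite divr_ge0// mulr_ge0 ?addr_ge0 ?(ltW r0) ?(ltW t0).
  rewrite ler_wpM2l// ler_wpM2l// lef_pV2 ?posrE ?exprn_gt0 ?mulr_gt0 ?addr_gt0//.
  nra.
have q1 : - q * (chi / (t * (chi + t ^+ 2))) <= `|q| * (chi / t ^+ 2).
  apply: (@le_trans _ _ (`|q| * (chi / (t * (chi + t ^+ 2))))).
    apply: ler_wpM2r; last by rewrite -normrN ler_norm.
    by rewrite divr_ge0// mulr_ge0 ?(ltW t0) ?(ltW s0).
  rewrite ler_wpM2l// ler_wpM2l// lef_pV2 ?posrE ?exprn_gt0 ?mulr_gt0//.
  nra.
rewrite e2 -subr_ge0.
have -> : phi - b + (a + q) / t + (`|b| + `|q|) * chi / t ^+ 2 -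
  (a / t + (phi - b * (t / r)) + q * (t^-1 - chi / (t * (chi + t ^+ 2)))) =
  (`|b| * (chi / t ^+ 2) - b * (1 - t / r)) +
  (`|q| * (chi / t ^+ 2) - - q * (chi / (t * (chi + t ^+ 2)))) by ring.
by rewrite addr_ge0// subr_ge0.
Qed.

(** The sign at infinity is that of the first nonzero coefficient. *)
Lemma envelope_rate_lt0 (R : realType) (d m M : R) : 0 <= M ->
  d < 0 \/ (d = 0 /\ m < 0) ->
  exists2 t0 : R, 1 <= t0 & forall t, t0 < t -> d + m / t + M / t ^+ 2 < 0.
Proof.
move=> M0 [d0|[-> m0]].
  exists (1 + (`|m| + M) / - d).
    by rewrite lerDl divr_ge0 ?addr_ge0// oppr_ge0 ltW.
  move=> t tt0; have t1 : 1 < t.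
    by apply: le_lt_trans tt0; rewrite lerDl divr_ge0 ?addr_ge0// oppr_ge0 ltW.
  have tp : 0 < t by apply: lt_trans t1.
  have : (`|m| + M) / - d < t by apply: lt_trans tt0; rewrite ltrDr.
  rewrite ltr_pdivrMr ?oppr_gt0// => h.
  have -> : d + m / t + M / t ^+ 2 = (d * t ^+ 2 + m * t + M) / t ^+ 2.
    by field; rewrite gt_eqF.
  rewrite pmulr_llt0 ?invr_gt0 ?exprn_gt0//.
  have mm := ler_norm m; nra.
exists (1 + M / - m); first by rewrite lerDl divr_ge0// oppr_ge0 ltW.
move=> t tt0; have t1 : 1 < t.
  by apply: le_lt_trans tt0; rewrite lerDl divr_ge0// oppr_ge0 ltW.
have tp : 0 < t by apply: lt_trans t1.
have : M / - m < t by apply: lt_trans tt0; rewrite ltrDr.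
rewrite ltr_pdivrMr ?oppr_gt0// => h.
have -> : 0 + m / t + M / t ^+ 2 = (m * t + M) / t ^+ 2.
  by field; rewrite gt_eqF.
by rewrite pmulr_llt0 ?invr_gt0 ?exprn_gt0//; nra.
Qed.

Lemma envelope_decr (R : realType) (a phi b chi q : R) : 0 <= chi ->
  phi < b \/ (phi = b /\ a + q < 0) ->
  exists2 t0 : R, 0 < t0 & forall s t, t0 < s -> s < t ->
    envelope a phi b chi q t < envelope a phi b chi q s.
Proof.
move=> chi0 hyp; pose M := (`|b| + `|q|) * chi.
have M0 : 0 <= M by rewrite mulr_ge0 ?addr_ge0.
have hyp' : phi - b < 0 \/ (phi - b = 0 /\ a + q < 0).
  by case: hyp => [?|[-> ?]]; [left; rewrite subr_lt0|right; rewrite subrr].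
have [t0 t01 neg] := envelope_rate_lt0 M0 hyp'.
exists t0; first exact: lt_le_trans t01.
pose L (t : R) : R := a * ln t + (phi * t - b * Num.sqrt (chi + t ^+ 2)) +
   q * ln (Num.sqrt (chi + t ^+ 2)).
have gt0 t : t0 < t -> 0 < t by apply: lt_trans; exact: lt_le_trans t01.
have s0 t : 0 < t -> 0 < chi + t ^+ 2 by move=> ?; rewrite ltr_wpDl ?exprn_gt0.
have LE t : t0 < t -> envelope a phi b chi q t = expR (L t).
  move=> /gt0 tp; rewrite /envelope /powR (gt_eqF tp) gt_eqF ?sqrtr_gt0 ?s0//.
  by rewrite -!expRD.
have dL (t : R) : 0 < t -> is_derive t 1 L (a / t +
    (phi - b * (t / Num.sqrt (chi + t ^+ 2))) + q * (t / (chi + t ^+ 2))).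
  move=> tp; have d1 := is_derive1_ln tp.
  have r0 : 0 < Num.sqrt (chi + t ^+ 2) by rewrite sqrtr_gt0 s0.
  have d2 : is_derive t 1 (fun t : R => chi + t ^+ 2) (2 * t).
    by apply: is_derive_eq; rewrite /GRing.scale/=; ring.
  have d3 : is_derive t 1 (fun t : R => Num.sqrt (chi + t ^+ 2))
      (t / Num.sqrt (chi + t ^+ 2)).
    have d4 := is_derive1_sqrt (s0 _ tp).
    apply: is_derive_eq (@is_derive1_comp R _ (fun t : R => chi + t ^+ 2) _ _ _ d4 d2) _.
    by field; rewrite gt_eqF.
  have d5 : is_derive t 1 (fun t : R => ln (Num.sqrt (chi + t ^+ 2)))
      (t / (chi + t ^+ 2)).
    have d6 := is_derive1_ln r0.
    apply: is_derive_eq (@is_derive1_comp R _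
      (fun t : R => Num.sqrt (chi + t ^+ 2)) _ _ _ d6 d3) _.
    rewrite -{3}(sqr_sqrtr (ltW (s0 _ tp))).
    by field; rewrite gt_eqF.
  by apply: is_derive_eq; rewrite /GRing.scale/= mulr1.
move=> s t ts st; have tt := lt_trans ts st.
rewrite !LE// ltr_expR.
apply: (@ltr0_derive1_lt_oo _ L t0 (t + 1)) => //.
- by move=> x; rewrite in_itv/= => /andP[/gt0/dL[]].
- move=> x; rewrite in_itv/= => /andP[tx _].
  have x1 : 1 <= x := le_trans t01 (ltW tx).
  have dLx := dL _ (gt0 _ tx); rewrite derive1E (@derive_val _ _ _ _ _ _ _ dLx).
  exact: le_lt_trans (log_envelope_derive_le a phi b q chi0 x1) (neg _ tx).
- move=> x; rewrite inE/= in_itv/= => /andP[/gt0/dL[+ _] _].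
  by move/derivable1_diffP/differentiable_continuous.
- by rewrite in_itv/= tt ltrDl ltr01.
- by rewrite in_itv/= ts (lt_trans st)// ltrDl.
Qed.

(** * The density as an exponential times an integral *)

(** The three formulas for the density differ only by the normalising
    constant. *)
Lemma gig_pdf_shape (R : realType) (lambda chi psi : R) :
  exists2 c : R, 0 <= c & forall w : R, 0 < w ->
    gig_pdf lambda chi psi w =
    c * (w `^ (lambda - 1) * expR (- (chi / w + psi * w) / 2)).
Proof.
have Gamma_ge0 (a : R) : 0 <= Gamma a.
  by apply: Rintegral_ge0 => w _; rewrite mulr_ge0 ?powR_ge0 ?expR_ge0.
rewrite /gig_pdf; have [->|_] := eqVneq psi 0.
  exists ((chi / 2) `^ (- lambda) / Gamma (- lambda)).
    by rewrite divr_ge0 ?powR_ge0.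
  move=> w w0; rewrite -!mulrA; do 3 congr (_ * _); congr expR.
  by rewrite mul0r addr0 invfM; ring.
have [->|_] := eqVneq chi 0.
  exists ((psi / 2) `^ lambda / Gamma lambda); first by rewrite divr_ge0 ?powR_ge0.
  move=> w w0; rewrite -!mulrA; do 3 congr (_ * _); congr expR.
  by rewrite mul0r add0r mulNr.
exists (chi `^ (- lambda) * Num.sqrt (chi * psi) `^ lambda /
        (2 * besselK lambda (Num.sqrt (chi * psi)))).
  apply: divr_ge0; first by apply: mulr_ge0; exact: powR_ge0.
  by apply: mulr_ge0 => //; exact: besselK_ge0.
move=> w w0; rewrite -!mulrA; do 4 congr (_ * _); congr expR.
by rewrite mulrC mulrN mulNr.
Qed.

Lemma gh1_pdf_shape (R : realType) (lambda chi psi phi : R) :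
  exists2 C : R, 0 <= C & forall t : R,
    gh1_pdf lambda chi psi phi t =
    C * (expR (phi * t) *
         gig_integral (lambda - 2^-1) (chi + t ^+ 2) (phi ^+ 2 + psi)).
Proof.
have [c c0 cE] := gig_pdf_shape lambda chi psi.
exists ((2 * pi) `^ (- 2^-1) * c); first by rewrite mulr_ge0 ?powR_ge0.
move=> t; rewrite mulrA /gh1_pdf /gig_integral -ge0_RintegralZl//.
- apply: eq_Rintegral => w; rewrite inE/= in_itv/= andbT => w0.
  rewrite cE// /gig_kernel powRM ?(ltW w0) ?mulr_ge0 ?pi_ge0//.
  have -> : w `^ (lambda - 2^-1 - 1) = w `^ (- 2^-1) * w `^ (lambda - 1).
    rewrite -powRD ?(gt_eqF w0) ?implybT//; congr (_ `^ _); ring.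
  have -> : expR (- ((chi + t ^+ 2) / w + (phi ^+ 2 + psi) * w) / 2) =
      expR (- (t ^+ 2 / (2 * w)) - phi ^+ 2 * w / 2) *
      expR (- (chi / w + psi * w) / 2).
    by rewrite -expRD; congr expR; rewrite invfM; ring.
  by rewrite -[phi * t - _ - _]addrA expRD; ring.
- exact: gig_kernel_measurable.
- by move=> w _; exact: gig_kernel_ge0.
- by rewrite !mulr_ge0 ?powR_ge0 ?expR_ge0.
Qed.

(** Total mass 1 forbids a density that vanishes off the origin. *)
Lemma density_neq0 d (T : measurableType d) (R : realType) (P : probability T R)
    (X : {RV P >-> R}) (f : R -> R) : has_density X f ->
  exists2 t : R, t != 0 & f t != 0.
Proof.
move=> [mf _ fE]; apply: contrapT => nf.
have f0 t : t != 0 -> f t = 0.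
  by move=> t0; apply: contrapT => /eqP ft; apply: nf; exists t.
have := fE setT measurableT; rewrite probability_setT.
rewrite -(@integral_setD1 _ _ 0); first last.
- by apply/measurable_EFinP; exact: measurable_funTS.
- by apply: measurableD => //; exact: measurable_set1.
rewrite integral0_eq; last by move=> t [_ /eqP /f0 ->].
by move/eqP; rewrite onee_eq0.
Qed.

(** * Eventual decrease in the three regimes *)

(** The common last step of all the cases: an eventually strictly decreasing
    envelope times a positive nonincreasing function. *)
Lemma envelope_mul_decr (R : realType) (a phi b chi q k : R) (B h : R -> R) :
  0 <= chi -> 0 < k -> phi < b \/ (phi = b /\ a + q < 0) ->
  (forall t : R, 0 < t -> 0 < B t) ->
  (forall s t : R, 0 < s -> s <= t -> B t <= B s) ->
  (forall t : R, 0 < t -> h t = k * (envelope a phi b chi q t * B t)) ->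
  exists2 t0 : R, 0 < t0 & forall s t, t0 < s -> s < t -> h t < h s.
Proof.
move=> chi0 k0 hyp B0 decB hE.
have [t0 t00 decE] := envelope_decr chi0 hyp.
exists t0 => // s t t0s st.
have s0 : 0 < s := lt_trans t00 t0s; have tp : 0 < t := lt_trans s0 st.
rewrite !hE// ltr_pM2l//.
apply: (@le_lt_trans _ _ (envelope a phi b chi q t * B s)).
  apply: ler_wpM2l; last exact: decB (ltW st).
  exact: ltW (envelope_gt0 _ _ _ _ chi0 tp).
by rewrite ltr_pM2r ?B0// decE.
Qed.

Lemma sqrt_add_sqr_le (R : realType) (chi s t : R) : 0 < s -> s <= t ->
  Num.sqrt (chi + s ^+ 2) <= Num.sqrt (chi + t ^+ 2).
Proof.
move=> s0 st; rewrite ler_wsqrtr// lerD2l lerXn2r ?nnegrE ?(ltW s0)//.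
exact: ltW (lt_le_trans s0 st).
Qed.

(** Multiplying and dividing by e^z, z = b sqrt(chi + t^2), trades the Bessel
    function for e^z K_p(z), at the price of the term - b sqrt(chi + t^2) in the
    exponent of the envelope. *)
Lemma gh1_envelope_factor (R : realType) (a phi chi p b t : R) :
  0 <= chi -> 0 < b -> 0 < t ->
  t `^ a * (expR (phi * t) * gig_integral p (chi + t ^+ 2) (b ^+ 2)) =
  2 * b `^ (- p) * (envelope a phi b chi p t *
    (expR (b * Num.sqrt (chi + t ^+ 2)) *
     besselK p (b * Num.sqrt (chi + t ^+ 2)))).
Proof.
move=> chi0 b0 t0.
have s0 : 0 < chi + t ^+ 2 by rewrite ltr_wpDl ?exprn_gt0.
rewrite gig_integralE ?exprn_gt0// !(sqrtrM _ (ltW s0)).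
rewrite sqrtrV ?exprn_ge0 ?(ltW b0)// sqrtr_sqr ger0_norm ?(ltW b0)//.
rewrite powRM ?sqrtr_ge0 ?invr_ge0 ?(ltW b0)// powR_V// [_ * b]mulrC.
rewrite /envelope expRD expRN.
set e := expR (b * _); have e0 : e != 0 by rewrite gt_eqF ?expR_gt0.
by field.
Qed.

(** When phi < b the envelope decays exponentially, so the crude monotonicity
    of e^z K_p(z) suffices, with no restriction on a. *)
Lemma gh1_decr_lt (R : realType) (a phi chi p b : R) :
  0 <= chi -> 0 < b -> phi < b ->
  exists2 t0 : R, 0 < t0 & forall s t, t0 < s -> s < t ->
    t `^ a * (expR (phi * t) * gig_integral p (chi + t ^+ 2) (b ^+ 2)) <
    s `^ a * (expR (phi * s) * gig_integral p (chi + s ^+ 2) (b ^+ 2)).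
Proof.
move=> chi0 b0 phib.
have z0 t : 0 < t -> 0 < b * Num.sqrt (chi + t ^+ 2).
  by move=> t0; rewrite mulr_gt0// sqrtr_gt0 ltr_wpDl ?exprn_gt0.
apply: (@envelope_mul_decr R a phi b chi p (2 * b `^ (- p)) (fun t =>
    expR (b * Num.sqrt (chi + t ^+ 2)) * besselK p (b * Num.sqrt (chi + t ^+ 2)))
  (fun t => t `^ a * (expR (phi * t) *
    gig_integral p (chi + t ^+ 2) (b ^+ 2)))).
- exact: chi0.
- by rewrite mulr_gt0// powR_gt0.
- by left.
- by move=> t /z0 ?; rewrite mulr_gt0 ?expR_gt0 ?besselK_gt0.
- move=> s t s0 st; apply: expR_besselK_nincr; first exact: z0.
  by rewrite ler_pM2l// sqrt_add_sqr_le.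
- by move=> t t0; exact: gh1_envelope_factor.
Qed.

(** When phi = b the exponential decay disappears. Using sqrt z e^z K_p(z) in
    place of e^z K_p(z) lowers the exponent of the envelope from p to p - 1/2,
    which gives the sharp bound on a. *)
Lemma gh1_decr_eq (R : realType) (a chi p b : R) :
  0 <= chi -> 0 < b -> 2^-1 <= `|p| -> a + p < 2^-1 ->
  exists2 t0 : R, 0 < t0 & forall s t, t0 < s -> s < t ->
    t `^ a * (expR (b * t) * gig_integral p (chi + t ^+ 2) (b ^+ 2)) <
    s `^ a * (expR (b * s) * gig_integral p (chi + s ^+ 2) (b ^+ 2)).
Proof.
move=> chi0 b0 p2 ap.
have z0 t : 0 < t -> 0 < b * Num.sqrt (chi + t ^+ 2).
  by move=> t0; rewrite mulr_gt0// sqrtr_gt0 ltr_wpDl ?exprn_gt0.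
pose z t := b * Num.sqrt (chi + t ^+ 2).
apply: (@envelope_mul_decr R a b b chi (p - 2^-1)
  (2 * b `^ (- p) / Num.sqrt b) (fun t =>
    Num.sqrt (z t) * (expR (z t) * besselK p (z t)))
  (fun t => t `^ a * (expR (b * t) *
    gig_integral p (chi + t ^+ 2) (b ^+ 2)))).
- exact: chi0.
- by rewrite divr_gt0 ?sqrtr_gt0// mulr_gt0// powR_gt0.
- by right; split => //; rewrite addrA subr_lt0.
- move=> t /z0 zt; rewrite mulr_gt0 ?sqrtr_gt0//.
  by rewrite mulr_gt0 ?expR_gt0 ?besselK_gt0.
- move=> s t s0 st; apply: sqrt_expR_besselK_nincr; [exact: p2|exact: z0|].
  by rewrite ler_pM2l// sqrt_add_sqr_le.
move=> t t0; rewrite gh1_envelope_factor// /z.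
have r0 : 0 < Num.sqrt (chi + t ^+ 2) by rewrite sqrtr_gt0 ltr_wpDl ?exprn_gt0.
have -> : envelope a b b chi p t = envelope a b b chi (p - 2^-1) t *
    Num.sqrt (Num.sqrt (chi + t ^+ 2)).
  rewrite /envelope -[RHS]mulrA; congr (_ * _).
  rewrite -[Num.sqrt (Num.sqrt _)]powR12_sqrt ?(ltW r0)// -powRD ?subrK//.
  by rewrite (gt_eqF r0) implybT.
rewrite sqrtrM ?(ltW b0)//.
have sb0 : Num.sqrt b != 0 by rewrite gt_eqF ?sqrtr_gt0.
by field.
Qed.

(** Necessity: t^a (chi + t^2)^p = t^(a + 2p) (1 + chi/t^2)^p, where both factors
    are nondecreasing when a + 2p >= 0. The case a + 2p = 0 is excluded because
    of chi > 0, which makes the second factor increase to its limit.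
    Sufficiency is the envelope with vanishing exponential part. *)
Lemma powR_shift_decr (R : realType) (a chi p : R) : 0 < chi -> p < 0 ->
  (exists2 t0 : R, 0 < t0 & forall s t, t0 < s -> s < t ->
    t `^ a * (chi + t ^+ 2) `^ p < s `^ a * (chi + s ^+ 2) `^ p) <->
  a + 2 * p < 0.
Proof.
move=> chi0 p0.
have s0 t : 0 < t -> 0 < chi + t ^+ 2 by move=> ?; rewrite ltr_wpDl ?exprn_gt0 ?ltW.
split=> [[t0 t00 dec]|ap].
  rewrite ltNge; apply/negP => ap.
  have [t1 t2] : t0 < t0 + 1 /\ t0 + 1 < t0 + 2 by split; lra.
  have := dec _ _ t1 t2; apply/negP; rewrite -leNgt.
  have u0 : 0 < t0 + 1 by lra.
  have v0 : 0 < t0 + 2 by lra.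
  move: (t0 + 1) (t0 + 2) u0 v0 t2 => u v u0 v0 uv {t1 dec}.
  have split t : 0 < t -> t `^ a * (chi + t ^+ 2) `^ p =
      t `^ (a + 2 * p) * (1 + chi / t ^+ 2) `^ p.
    move=> t0'; have -> : chi + t ^+ 2 = t ^+ 2 * (1 + chi / t ^+ 2).
      by field; rewrite gt_eqF.
    rewrite powRM ?exprn_ge0 ?addr_ge0 ?divr_ge0 ?exprn_ge0 ?(ltW t0') ?(ltW chi0)//.
    by rewrite powRD ?(gt_eqF t0') ?implybT// powRrM powR_mulrn ?(ltW t0')// mulrA.
  rewrite !split//; apply: ler_pM; rewrite ?powR_ge0//.
    by apply: ge0_ler_powR; rewrite ?nnegrE ?(ltW u0) ?(ltW v0) ?(ltW uv).
  have powNE w : w `^ p = (w `^ (- p))^-1 by rewrite -powRN opprK.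
  rewrite !powNE lef_pV2 ?posrE ?powR_gt0 ?addr_gt0 ?divr_gt0 ?exprn_gt0//.
  apply: ge0_ler_powR; rewrite ?nnegrE ?oppr_ge0 ?(ltW p0)//.
  - by rewrite addr_ge0// divr_ge0 ?exprn_ge0 ?(ltW chi0) ?(ltW v0).
  - by rewrite addr_ge0// divr_ge0 ?exprn_ge0 ?(ltW chi0) ?(ltW u0).
  - rewrite lerD2l ler_pM2l// lef_pV2 ?posrE ?exprn_gt0//.
    by rewrite lerXn2r ?nnegrE ?(ltW u0) ?(ltW v0) ?(ltW uv).
apply: (@envelope_mul_decr R a 0 0 chi (2 * p) 1 (fun=> 1)
  (fun t => t `^ a * (chi + t ^+ 2) `^ p)).
- exact: ltW.
- exact: ltr01.
- by right.
- by [].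
- by [].
- move=> t t0; rewrite mul1r mulr1 /envelope !mul0r subrr expR0 mulr1.
  rewrite powRrM powR_mulrn ?sqrtr_ge0//.
  by rewrite sqr_sqrtr// ltW// s0.
Qed.

Lemma gig_admissible_chi_ge0 (R : realType) (lambda chi psi : R) :
  gig_admissible lambda chi psi -> 0 <= chi.
Proof.
by case=> neg zero pos; have [/neg[/ltW]|/pos[]|/zero[/ltW]] := ltgtP lambda 0.
Qed.

Lemma gig_admissible_psi0 (R : realType) (lambda chi : R) :
  gig_admissible lambda chi 0 -> lambda < 0 /\ 0 < chi.
Proof.
case=> neg zero pos; have [l0|/pos[]|/zero[]] := ltgtP lambda 0; rewrite ?ltxx//.
by have [] := neg l0.
Qed.

(** The constant is positive and the integral is nonzero at some point because
    the density does not vanish; the second fact is what makes I(1) positive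
    in the case psi = phi = 0, where the integral is a multiple of it. *)
Lemma gh1_density_shape d (T : measurableType d) (R : realType)
    (P : probability T R) (X : {RV P >-> R}) (lambda chi psi phi : R)
    (f : R -> R) : 0 <= chi -> 0 <= psi ->
  is_gh1_density X lambda chi psi phi f ->
  {within `]0, +oo[, continuous f} /\
  exists C : R, [/\ 0 < C,
    (forall t : R, t != 0 -> f t = C * (expR (phi * t) *
      gig_integral (lambda - 2^-1) (chi + t ^+ 2) (phi ^+ 2 + psi))) &
    exists2 t : R, t != 0 &
      gig_integral (lambda - 2^-1) (chi + t ^+ 2) (phi ^+ 2 + psi) != 0].
Proof.
move=> chi0 psi0 [dens fE]; have [C C0 gE] := gh1_pdf_shape lambda chi psi phi.
have {}fE t : t != 0 -> f t = C * (expR (phi * t) *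
    gig_integral (lambda - 2^-1) (chi + t ^+ 2) (phi ^+ 2 + psi)).
  by move=> t0; rewrite fE// gE.
split.
  apply: continuous_in_subspaceT => t; rewrite inE/= in_itv/= andbT => t0.
  have ch : (C * (expR (phi * x) *
      gig_integral (lambda - 2^-1) (chi + x ^+ 2) (phi ^+ 2 + psi))) @[x --> t] -->
      C * (expR (phi * t) *
      gig_integral (lambda - 2^-1) (chi + t ^+ 2) (phi ^+ 2 + psi)).
    apply: cvgM; first exact: cvg_cst.
    apply: cvgM.
      apply: continuous_cvg; first exact: continuous_expR.
      by apply: cvgM; [exact: cvg_cst|exact: cvg_id].
    apply: (@cvg_comp _ _ _ (fun x : R => chi + x ^+ 2)
      (fun s => gig_integral (lambda - 2^-1) s (phi ^+ 2 + psi))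
      _ (nbhs (chi + t ^+ 2))).
      by apply: cvgD; [exact: cvg_cst|exact: exprn_continuous].
    apply: gig_integral_continuous; last by rewrite addr_ge0 ?sqr_ge0.
    by rewrite ltr_wpDl ?exprn_gt0.
  rewrite /continuous_at fE ?(gt_eqF t0)//.
  apply: cvg_trans ch; apply: near_eq_cvg.
  near=> x; rewrite fE// gt_eqF//; near: x; exact: lt_nbhsr.
exists C; have [t t0 ft0] := density_neq0 dens.
move: (ft0); rewrite fE// !mulf_eq0 !negb_or => /and3P[Cneq0 _ It].
by split=> //; [rewrite lt_neqAle eq_sym Cneq0|exists t].
Unshelve. all: end_near. Qed.

Theorem theorem6 (R : realType) (lambda chi psi phi : R)
    (hadm : gig_admissible lambda chi psi)
    (d : measure_display) (T : measurableType d) (P : probability T R)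
    (xi : {RV P >-> R}) (hxi : has_gh1_law xi lambda chi psi 0 1 phi)
    (f : R -> R) (hf : is_gh1_density xi lambda chi psi phi f) :
  [/\ 0 < psi ->
        forall alpha : R,
          exists2 t0 : R, 0 < t0 & alpha_decreasing_above f alpha t0,
      psi = 0 -> phi != 0 ->
        (phi < 0 -> forall alpha : R, alpha_decreasing f alpha) /\
        (0 < phi -> forall alpha : R, alpha < 1 - lambda ->
           alpha_decreasing f alpha) &
      psi = 0 -> phi = 0 ->
        forall alpha : R,
          alpha_decreasing f alpha <-> (lambda < 0 /\ alpha < 1 - 2 * lambda)].
Proof.
have chi0 := gig_admissible_chi_ge0 hadm.
have shape psi0 := @gh1_density_shape _ _ _ _ _ _ _ _ _ _ chi0 psi0 hf.
have decrI (a b : R) : 0 <= psi -> phi ^+ 2 + psi = b ^+ 2 ->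
    (exists2 t0 : R, 0 < t0 & forall s t, t0 < s -> s < t ->
      t `^ a * (expR (phi * t) *
        gig_integral (lambda - 2^-1) (chi + t ^+ 2) (b ^+ 2)) <
      s `^ a * (expR (phi * s) *
        gig_integral (lambda - 2^-1) (chi + s ^+ 2) (b ^+ 2))) ->
    alpha_decreasing f a.
  move=> psi0 <- [t0 t00 dec]; have [cf [C [C0 fE _]]] := shape psi0.
  exists t0 => //; split=> // s t t0s st.
  have s0 := lt_trans t00 t0s; have tp := lt_trans s0 st.
  rewrite !fE ?gt_eqF// ![_ `^ a * (C * _)]mulrCA ltr_pM2l//.
  exact: dec.
split.
- move=> psi0 alpha; pose b := Num.sqrt (phi ^+ 2 + psi).
  have b2 : 0 < phi ^+ 2 + psi by rewrite ltr_wpDl ?sqr_ge0.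
  apply: (decrI alpha b); rewrite ?(ltW psi0)// ?sqr_sqrtr ?(ltW b2)//.
  rewrite -[phi ^+ 2 + psi](sqr_sqrtr (ltW b2)).
  apply: gh1_decr_lt; rewrite // ?sqrtr_gt0//.
  apply: le_lt_trans (ler_norm phi) _.
  by rewrite -sqrtr_sqr ltr_sqrt// ltrDl.
- move=> psi0 _; move: hadm; rewrite psi0 => /gig_admissible_psi0[l0 _].
  split=> [phi0 alpha|phi0 alpha al].
    apply: (decrI alpha (- phi)); [by rewrite psi0|by rewrite psi0 addr0 sqrrN|].
    by apply: gh1_decr_lt => //; rewrite ?oppr_gt0//; lra.
  apply: (decrI alpha phi); rewrite ?psi0 ?addr0//.
  apply: gh1_decr_eq => //; last lra.
  by rewrite ltr0_norm; lra.
- move=> psi0 phi0 alpha; move: hadm; rewrite psi0 => /gig_admissible_psi0[l0 chip].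
  have psi_ge0 : 0 <= psi by rewrite psi0.
  have [cf [C [C0 fE [u u0 Iu]]]] := shape psi_ge0.
  have s0 t : 0 < chi + t ^+ 2 by rewrite ltr_wpDr ?sqr_ge0.
  have b0 : phi ^+ 2 + psi = 0 by rewrite phi0 psi0 expr0n/= addr0.
  pose k := C * gig_integral (lambda - 2^-1) 1 0.
  have {}fE t : t != 0 -> f t = k * (chi + t ^+ 2) `^ (lambda - 2^-1).
    move=> t0; rewrite fE// b0 phi0 mul0r expR0 mul1r gig_integral0E//.
    by rewrite /k -mulrA [_ `^ _ * _]mulrC.
  have k0 : 0 < k.
    rewrite mulr_gt0// lt_neqAle gig_integral_ge0 andbT eq_sym.
    by apply: contra_neq Iu => I0; rewrite b0 gig_integral0E// I0 mulr0.
  have p0 : lambda - 2^-1 < 0 by lra.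
  have equiv := powR_shift_decr alpha chip p0.
  have fdec (s t : R) : 0 < s -> 0 < t -> (t `^ alpha * f t < s `^ alpha * f s) =
      (t `^ alpha * (chi + t ^+ 2) `^ (lambda - 2^-1) <
       s `^ alpha * (chi + s ^+ 2) `^ (lambda - 2^-1)).
    move=> sp tp; rewrite !fE ?gt_eqF// ![_ `^ alpha * (k * _)]mulrCA.
    by rewrite ltr_pM2l.
  split=> [[t0 t00 [_ dec]]|[_ al]].
    split=> //; suff : alpha + 2 * (lambda - 2^-1) < 0 by lra.
    apply/equiv; exists t0 => // s t t0s st.
    have sp := lt_trans t00 t0s; have tp := lt_trans sp st.
    by rewrite -fdec// dec.
  have /equiv[t0 t00 dec] : alpha + 2 * (lambda - 2^-1) < 0 by lra.
  exists t0 => //; split=> // s t t0s st.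
  have sp := lt_trans t00 t0s; have tp := lt_trans sp st.
  by rewrite fdec// dec.
Qed.
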